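(* For all integers $c>0$, $d>0$, $n\ge 0$, all $m\in\mathbb{N}$ and all $\lambda,\mu,\nu\in\mathbb{C}$, the following symmetry identity, in the variables $x,y,X,Y$, holds for the 2-variable generalized Laguerre Apostol type polynomials ${}_{{}_sL}\mathcal{F}_n^{(m)}(y,x;\lambda;\mu,\nu)$: $$\sum_{k=0}^{n}\binom{n}{k}c^{n-k}d^{\nu+k}\,{}_{{}_sL}\mathcal{F}_{n-k}^{(m)}(d^{s}y,dx;\lambda;\mu,\nu)\sum_{l=0}^{k}\binom{k}{l}\mathcal{S}_{l}(c-1,-\lambda)\,{}_{{}_sL}\mathcal{F}_{k-l}^{(m-1)}(c^{s}Y,cX;\lambda;\mu,\nu)$$ $$=\sum_{k=0}^{n}\binom{n}{k}d^{n-k}c^{\nu+k}\,{}_{{}_sL}\mathcal{F}_{n-k}^{(m)}(c^{s}y,cx;\lambda;\mu,\nu)\sum_{l=0}^{k}\binom{k}{l}\mathcal{S}_{l}(d-1,-\lambda)\,{}_{{}_sL}\mathcal{F}_{k-l}^{(m-1)}(d^{s}Y,dX;\lambda;\mu,\nu).$$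
   Context: Here $\mathbb{N}=\{1,2,\dots\}$, $s$ is the (positive integer) index of the 2-variable generalized Laguerre polynomials ${}_sL_n(y,x)$, whose generating function is $e^{xt}C_0(-yt^s)$, and $C_0(u)=\sum_{r=0}^\infty \frac{(-1)^r u^r}{(r!)^2}$ is the Bessel-Tricomi function of order zero. The 2-variable generalized Laguerre Apostol type polynomials ${}_{{}_sL}\mathcal{F}_n^{(m)}(y,x;\lambda;\mu,\nu)$ of order $m$ (with $m=0$ also allowed; note the order of arguments, first $y$, then $x$) are defined by the generating function $$\Big(\frac{2^\mu t^\nu}{\lambda e^{t}+1}\Big)^m e^{xt}\,C_0(-yt^s)=\sum_{n=0}^{\infty}{}_{{}_sL}\mathcal{F}_n^{(m)}(y,x;\lambda;\mu,\nu)\frac{t^{n}}{n!}.$$ For an arbitrary real or complex number $a$, the generalized sums of integer powers $\mathcal{S}_k(n,a)$ are defined by $$\sum_{k=0}^{\infty}\mathcal{S}_{k}(n,a)\frac{t^k}{k!}=\frac{a e^{(n+1)t}-1}{a e^{t}-1}.$$ *)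

(* Defs.v *)
From Stdlib Require Import Reals Factorial ClassicalEpsilon.
From Coquelicot Require Import Coquelicot.

Open Scope C_scope.

Definition Cexp (z : C) : C :=
  ((exp (Re z) * cos (Im z))%R, (exp (Re z) * sin (Im z))%R).

(* Principal argument, in (-PI, PI]; the value at 0 is irrelevant. *)
Definition Carg (z : C) : R :=
  if Rle_dec 0 (Im z) then acos (Re z / Cmod z) else (- acos (Re z / Cmod z))%R.

Definition Clog (z : C) : C := (ln (Cmod z), Carg z).

(* z ^ w with complex exponent, for z <> 0, principal branch. *)
Definition Cpower (z w : C) : C := Cexp (w * Clog z).

(* Series with coefficients (-1)^r / (r!)^2; it converges for every u, so that
   [iota] picks out its unique sum. *)
Definition bessel_tricomi0 (u : C) : C :=
  iota (T := C_CompleteNormedModule)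
    (fun l => is_series (K := C_AbsRing) (V := C_NormedModule)
       (fun r : nat => RtoC (-1) ^ r * u ^ r / RtoC (INR (fact r)) ^ 2) l).

(* g(t) = sum_n a_n t^n / n! for all complex t in a punctured neighbourhood of 0.
   The point 0 is excluded because g may be written as a quotient with a
   removable singularity there, e.g. t / (e^t - 1). *)
Definition is_egf (g : C -> C) (a : nat -> C) : Prop :=
  locally' (RtoC 0) (fun t : C =>
    is_pseries (K := C_AbsRing) (V := C_NormedModule)
      (fun n : nat => a n / RtoC (INR (fact n))) t (g t)).

(* The sequence a with g(t) = sum_n a_n t^n / n!; such a sequence is unique.
   If g has no power series expansion at 0, the value is 0 by convention. *)
Definition egf_coef (g : C -> C) : nat -> C :=
  match excluded_middle_informative (exists a : nat -> C, is_egf g a) with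
  | left H => proj1_sig (constructive_indefinite_description (is_egf g) H)
  | right _ => fun _ => RtoC 0
  end.

(* The coefficient of t^n / n! in
     (2^mu t^nu / (lambda e^t + 1))^m e^(x t) C_0(- y t^s).
   For m >= 1 this function of t is a power series at 0 only for suitable nu
   (m * nu a natural number, at least m if lambda = -1). For other nu the
   polynomials do not exist, whatever x and y, and the value is 0. *)
Definition laguerre_apostol (s m : nat) (lambda mu nu : C) (n : nat) (y x : C) : C :=
  egf_coef (fun t : C =>
    (Cpower (RtoC 2) mu * Cpower t nu / (lambda * Cexp t + RtoC 1)) ^ m
    * Cexp (x * t) * bessel_tricomi0 (- y * t ^ s)) n.

(* S_k(n, a). The numerator has the factor a, not a^(n+1). *)
Definition power_sum (k n : nat) (a : C) : C :=
  egf_coef (fun t : C =>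
    (a * Cexp (RtoC (INR (n + 1)) * t) - RtoC 1) / (a * Cexp t - RtoC 1)) k.

(* Main.v *)
Require Import Defs.
From Stdlib Require Import Reals Lra Lia Factorial ClassicalEpsilon.
From Coquelicot Require Import Coquelicot.

Open Scope C_scope.

(* Both sides are the n-th coefficient of a product of generating functions,
   d^nu G_m(c t) S_{c-1}(d t) G_{m-1}(d t) and the same with c and d exchanged.
   Since (c t)^nu = c^nu t^nu for c > 0, and S_{c-1}(d t) is the quotient
   (lambda e^{c d t} + 1) / (lambda e^{d t} + 1), the product is symmetric in c and d.

   The polynomials of order m have the value 0 when the generating function has no
   expansion at 0. Whether it has one does not depend on x and y, because
   e^{x t} C_0(- y t^s) is an invertible power series; so if order m or order m - 1
   is missing, both sides vanish. Invertibility of power series with nonzero constant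
   term also gives the uniqueness of coefficients and the expansion of S_k(n, a). *)

(** * Complex power series at 0 *)

Notation is_Cseries := (is_series (K := C_AbsRing) (V := C_NormedModule)).

Lemma fst_sum_n (u : nat -> C) (n : nat) :
  fst (sum_n (G := C_AbelianMonoid) u n) = sum_n (fun k => fst (u k)) n.
Proof.
  induction n as [|n IH]; [now rewrite !sum_O|].
  rewrite !sum_Sn, <- IH; reflexivity.
Qed.

Lemma snd_sum_n (u : nat -> C) (n : nat) :
  snd (sum_n (G := C_AbelianMonoid) u n) = sum_n (fun k => snd (u k)) n.
Proof.
  induction n as [|n IH]; [now rewrite !sum_O|].
  rewrite !sum_Sn, <- IH; reflexivity.
Qed.

(** Balls in [C] are products of balls in the two coordinates, so the limit of the partial sums can
    be taken coordinatewise. This transfers facts on real series to complex ones. *)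
Lemma is_Cseries_split (u : nat -> C) (l : C) :
  is_Cseries u l <->
  is_series (fun n => fst (u n)) (fst l) /\ is_series (fun n => snd (u n)) (snd l).
Proof.
  unfold is_series; split.
  - intros H; split; apply filterlim_locally; intros eps;
      generalize (proj1 (filterlim_locally (U := C_UniformSpace) _ _) H eps);
      apply filter_imp; intros n [H1 H2]; [rewrite <- fst_sum_n | rewrite <- snd_sum_n]; assumption.
  - intros [H1 H2]; apply (filterlim_locally (U := C_UniformSpace)); intros eps.
    generalize (filter_and _ _ (proj1 (filterlim_locally _ _) H1 eps)
                  (proj1 (filterlim_locally _ _) H2 eps)).
    apply filter_imp; intros n [A B]; split; [rewrite fst_sum_n | rewrite snd_sum_n]; assumption.
Qed.

Lemma is_Cseries_unique (u : nat -> C) (l l' : C) :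
  is_Cseries u l -> is_Cseries u l' -> l = l'.
Proof.
  intros H H'; apply is_Cseries_split in H, H'; destruct H as [A B], H' as [A' B'].
  apply injective_projections;
    [apply is_series_unique in A, A' | apply is_series_unique in B, B']; congruence.
Qed.

Lemma ex_series_Rabs_le_Cmod (p : C -> R) (u : nat -> C) :
  (forall z, Rabs (p z) <= Cmod z)%R ->
  ex_series (fun n => Cmod (u n)) -> ex_series (fun n => Rabs (p (u n))).
Proof.
  intros Hp H; apply (ex_series_le (K := R_AbsRing) (V := R_CompleteNormedModule) _ (fun n => Cmod (u n)));
    [|exact H].
  intros n; change (Rabs (Rabs (p (u n))) <= Cmod (u n))%R; rewrite Rabs_Rabsolu; apply Hp.
Qed.

Lemma Rabs_snd_le_Cmod (z : C) : (Rabs (snd z) <= Cmod z)%R.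
Proof. apply Rle_trans with (2 := Rmax_Cmod z), Rmax_r. Qed.

(** The Cauchy product splits into four real Cauchy products of coordinates, each absolutely
    convergent because a coordinate is bounded by [Cmod]. *)
Lemma is_Cseries_mult (u v : nat -> C) (l l' : C) :
  is_Cseries u l -> is_Cseries v l' ->
  ex_series (fun n => Cmod (u n)) -> ex_series (fun n => Cmod (v n)) ->
  is_Cseries (fun n => sum_n (fun k => u k * v (n - k)%nat) n) (l * l').
Proof.
  intros Hu Hv Au Av; apply is_Cseries_split in Hu, Hv.
  destruct Hu as [U1 U2], Hv as [V1 V2].
  pose proof (ex_series_Rabs_le_Cmod fst u re_le_Cmod Au) as AU1.
  pose proof (ex_series_Rabs_le_Cmod snd u Rabs_snd_le_Cmod Au) as AU2.
  pose proof (ex_series_Rabs_le_Cmod fst v re_le_Cmod Av) as AV1.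
  pose proof (ex_series_Rabs_le_Cmod snd v Rabs_snd_le_Cmod Av) as AV2.
  apply is_Cseries_split; split.
  - eapply is_series_ext;
      [|exact (is_series_minus _ _ _ _ (is_series_mult _ _ _ _ U1 V1 AU1 AV1)
                 (is_series_mult _ _ _ _ U2 V2 AU2 AV2))].
    intros n; cbv beta; etransitivity; [|symmetry; etransitivity; [apply fst_sum_n|apply sum_n_Reals]].
    change (sum_f_R0 (fun k => fst (u k) * fst (v (n - k)%nat)) n
            - sum_f_R0 (fun k => snd (u k) * snd (v (n - k)%nat)) n
            = sum_f_R0 (fun k => fst (u k * v (n - k)%nat)%C) n)%R.
    rewrite <- minus_sum; apply sum_eq; reflexivity.
  - eapply is_series_ext;
      [|exact (is_series_plus _ _ _ _ (is_series_mult _ _ _ _ U1 V2 AU1 AV2)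
                 (is_series_mult _ _ _ _ U2 V1 AU2 AV1))].
    intros n; cbv beta; etransitivity; [|symmetry; etransitivity; [apply snd_sum_n|apply sum_n_Reals]].
    change (sum_f_R0 (fun k => fst (u k) * snd (v (n - k)%nat)) n
            + sum_f_R0 (fun k => snd (u k) * fst (v (n - k)%nat)) n
            = sum_f_R0 (fun k => snd (u k * v (n - k)%nat)%C) n)%R.
    rewrite <- plus_sum; apply sum_eq; intros; simpl; ring.
Qed.

Lemma ex_Cseries_of_abs (u : nat -> C) :
  ex_series (fun n => Cmod (u n)) -> exists l, is_Cseries u l.
Proof.
  intros H.
  destruct (ex_series_Rabs _ (ex_series_Rabs_le_Cmod fst u re_le_Cmod H)) as [l1 H1].
  destruct (ex_series_Rabs _ (ex_series_Rabs_le_Cmod snd u Rabs_snd_le_Cmod H)) as [l2 H2].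
  exists (l1, l2); apply is_Cseries_split; now split.
Qed.

(** * Expansions at 0 and growth of their coefficients *)

Definition has_power_series (g : C -> C) (a : nat -> C) : Prop :=
  exists r : R, (0 < r)%R /\
    forall t : C, t <> 0 -> (Cmod t < r)%R -> is_Cseries (fun n => a n * t ^ n) (g t).

(** This expresses a positive radius of convergence as an inequality on each coefficient, a form
    suited to induction on the index. *)
Definition geometric_bound (a : nat -> C) : Prop :=
  exists M R : R, (0 <= M)%R /\ (0 < R)%R /\ forall n, (Cmod (a n) <= M * R ^ n)%R.

Lemma is_Cseries_bounded (u : nat -> C) (l : C) :
  is_Cseries u l -> exists M, (0 <= M)%R /\ forall n, (Cmod (u n) <= M)%R.
Proof.
  intros H; apply is_Cseries_split in H; destruct H as [H1 H2].
  assert (B : forall v : nat -> R, ex_series v -> exists M, forall n, (Rabs (v n) <= M)%R).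
  { intros v Hv.
    destruct (maj_by_pos v) as [M [_ HM]]; [|now exists M].
    exists 0%R; apply is_lim_seq_Reals, ex_series_lim_0, Hv. }
  destruct (B _ (ex_intro _ _ H1)) as [M1 B1].
  destruct (B _ (ex_intro _ _ H2)) as [M2 B2].
  assert (Hn : forall n, (Cmod (u n) <= sqrt 2 * (M1 + M2))%R).
  { intros n; apply Rle_trans with (1 := Cmod_2Rmax (u n)).
    apply Rmult_le_compat_l; [apply sqrt_pos|].
    specialize (B1 n); specialize (B2 n).
    pose proof (Rabs_pos (fst (u n))); pose proof (Rabs_pos (snd (u n))).
    apply Rmax_lub; lra. }
  exists (sqrt 2 * (M1 + M2))%R; split; [|exact Hn].
  apply Rle_trans with (2 := Hn 0%nat), Cmod_ge_0.
Qed.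

Lemma RtoC_neq_0 (x : R) : x <> 0%R -> RtoC x <> 0.
Proof. intros H E; apply H; now injection E. Qed.

(** The terms at the single point [r / 2] are bounded by some [M]; dividing by the power of that
    point bounds the coefficients. *)
Lemma has_power_series_geometric_bound (g : C -> C) (a : nat -> C) :
  has_power_series g a -> geometric_bound a.
Proof.
  intros [r [Hr H]].
  set (t := (r / 2)%R).
  assert (Ht : (0 < t)%R) by (unfold t; lra).
  assert (Ht0 : RtoC t <> 0) by (apply RtoC_neq_0; lra).
  specialize (H (RtoC t) Ht0).
  rewrite Cmod_R, Rabs_pos_eq in H by lra.
  destruct (is_Cseries_bounded _ _ (H ltac:(unfold t; lra))) as [M [HM B]].
  exists M, (/ t)%R; split; [exact HM|]; split; [now apply Rinv_0_lt_compat|].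
  intros n; specialize (B n).
  rewrite Cmod_mult, Cmod_pow, Cmod_R, Rabs_pos_eq in B by lra.
  assert (Hp : (0 < t ^ n)%R) by now apply pow_lt.
  rewrite pow_inv; apply Rmult_le_reg_r with (1 := Hp).
  rewrite Rmult_assoc, Rinv_l, Rmult_1_r; [exact B|lra].
Qed.

(** For [Cmod t < / R] the terms are dominated by a geometric series of ratio [R * Cmod t]. *)
Lemma geometric_bound_abs_series (a : nat -> C) :
  geometric_bound a -> exists r : R, (0 < r)%R /\
    forall t : C, (Cmod t < r)%R -> ex_series (fun n => Cmod (a n * t ^ n)).
Proof.
  intros [M [R [HM [HR B]]]]; exists (/ R)%R; split; [now apply Rinv_0_lt_compat|].
  intros t Ht.
  apply (ex_series_le (K := R_AbsRing) (V := R_CompleteNormedModule) _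
           (fun n => M * (R * Cmod t) ^ n)%R).
  - intros n; change (Rabs (Cmod (a n * t ^ n)) <= M * (R * Cmod t) ^ n)%R.
    rewrite Rabs_pos_eq by apply Cmod_ge_0.
    rewrite Cmod_mult, Cmod_pow, Rpow_mult_distr, <- Rmult_assoc.
    apply Rmult_le_compat_r; [apply pow_le, Cmod_ge_0|apply B].
  - apply (ex_series_scal_l (K := R_AbsRing) (V := R_NormedModule) M), ex_series_geom.
    pose proof (Cmod_ge_0 t).
    rewrite Rabs_pos_eq by nra.
    apply Rmult_lt_compat_l with (r := R) in Ht; [|exact HR].
    rewrite Rinv_r in Ht; lra.
Qed.

(** Convergence near 0 gives geometric bounds, hence the absolute convergence that the Cauchy
    product requires, possibly on a smaller disc. *)
Lemma has_power_series_mult (f g : C -> C) (a b : nat -> C) :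
  has_power_series f a -> has_power_series g b ->
  has_power_series (fun t => f t * g t) (fun n => sum_n (fun k => a k * b (n - k)%nat) n).
Proof.
  intros Ha Hb.
  destruct (geometric_bound_abs_series a (has_power_series_geometric_bound _ _ Ha))
    as [r1 [Hr1 A]].
  destruct (geometric_bound_abs_series b (has_power_series_geometric_bound _ _ Hb))
    as [r2 [Hr2 B]].
  destruct Ha as [r3 [Hr3 Ha]], Hb as [r4 [Hr4 Hb]].
  exists (Rmin (Rmin r1 r2) (Rmin r3 r4)); split; [repeat apply Rmin_pos; assumption|].
  intros t Ht Hlt.
  apply Rmin_Rgt_l in Hlt; destruct Hlt as [H12 H34].
  apply Rmin_Rgt_l in H12; apply Rmin_Rgt_l in H34.
  eapply is_series_ext;
    [|exact (is_Cseries_mult _ _ _ _ (Ha t Ht (proj1 H34)) (Hb t Ht (proj2 H34))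
               (A t (proj1 H12)) (B t (proj2 H12)))].
  intros n; simpl.
  etransitivity;
    [|exact (sum_n_mult_r (K := C_Ring) (t ^ n) (fun k => a k * b (n - k)%nat) n)].
  apply sum_n_ext_loc; intros k Hk.
  change (a k * t ^ k * (b (n - k)%nat * t ^ (n - k)) = a k * b (n - k)%nat * t ^ n).
  replace n with (k + (n - k))%nat at 4 by lia; rewrite Cpow_add_r; ring.
Qed.

Lemma has_power_series_ext (f g : C -> C) (a b : nat -> C) :
  (forall t : C, t <> 0 -> f t = g t) -> (forall n, a n = b n) ->
  has_power_series f a -> has_power_series g b.
Proof.
  intros Hfg Hab [r [Hr H]]; exists r; split; [exact Hr|].
  intros t Ht Hlt; rewrite <- (Hfg t Ht).
  eapply is_series_ext; [|exact (H t Ht Hlt)].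
  intros n; simpl; now rewrite Hab.
Qed.

Lemma has_power_series_eventually_eq (f g : C -> C) (a : nat -> C) (r : R) :
  (0 < r)%R -> (forall t : C, t <> 0 -> (Cmod t < r)%R -> f t = g t) ->
  has_power_series f a -> has_power_series g a.
Proof.
  intros Hr Hfg [r' [Hr' H]]; exists (Rmin r r'); split; [now apply Rmin_pos|].
  intros t Ht Hlt; apply Rmin_Rgt_l in Hlt; destruct Hlt as [H1 H2].
  rewrite <- (Hfg t Ht H1); now apply H.
Qed.

Lemma has_power_series_function_unique (f g : C -> C) (a : nat -> C) :
  has_power_series f a -> has_power_series g a ->
  exists r : R, (0 < r)%R /\ forall t : C, t <> 0 -> (Cmod t < r)%R -> f t = g t.
Proof.
  intros [r1 [Hr1 H1]] [r2 [Hr2 H2]]; exists (Rmin r1 r2); split; [now apply Rmin_pos|].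
  intros t Ht Hlt; apply Rmin_Rgt_l in Hlt; destruct Hlt as [A B].
  exact (is_Cseries_unique _ _ _ (H1 t Ht A) (H2 t Ht B)).
Qed.

Lemma geometric_bound_has_power_series (a : nat -> C) :
  geometric_bound a -> exists g, has_power_series g a.
Proof.
  intros H; destruct (geometric_bound_abs_series a H) as [r [Hr A]].
  exists (fun t => epsilon (inhabits (RtoC 0)) (fun l => is_Cseries (fun n => a n * t ^ n) l)).
  exists r; split; [exact Hr|]; intros t _ Ht.
  exact (epsilon_spec _ _ (ex_Cseries_of_abs _ (A t Ht))).
Qed.

(** * Reciprocals of power series *)

Definition one_coef (n : nat) : C := match n with O => 1 | S _ => 0 end.

Lemma has_power_series_one : has_power_series (fun _ => RtoC 1) one_coef.
Proof.
  exists 1%R; split; [lra|]; intros t _ _.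
  unfold is_series; apply filterlim_ext with (f := fun _ : nat => RtoC 1);
    [|apply filterlim_const].
  induction x as [|n IH].
  - rewrite sum_O; simpl; ring.
  - rewrite sum_Sn, <- IH; change (RtoC 1 = 1 + 0 * t ^ S n); ring.
Qed.

Lemma sum_n_shift (u : nat -> C) (n : nat) :
  sum_n (G := C_AbelianMonoid) u (S n)
  = u 0%nat + sum_n (G := C_AbelianMonoid) (fun k => u (S k)) n.
Proof.
  unfold sum_n; rewrite sum_Sn_m by lia; now rewrite <- sum_n_m_S.
Qed.

Lemma Cmod_sum_n_le (u : nat -> C) (v : nat -> R) (n : nat) :
  (forall k, (k <= n)%nat -> (Cmod (u k) <= v k)%R) ->
  (Cmod (sum_n (G := C_AbelianMonoid) u n) <= sum_f_R0 v n)%R.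
Proof.
  induction n as [|n IH]; intros H.
  - rewrite sum_O; apply H; lia.
  - rewrite sum_Sn, tech5.
    apply Rle_trans with (1 := Cmod_triangle _ _), Rplus_le_compat; [|apply H; lia].
    apply IH; intros k Hk; apply H; lia.
Qed.

(** The factorization of a difference of powers; it evaluates the majorant of the recursion for
    reciprocal coefficients. *)
Lemma sum_geometric_product (x y : R) (n : nat) :
  sum_f_R0 (fun k => (y - x) * x ^ k * y ^ (n - k))%R n = (y ^ S n - x ^ S n)%R.
Proof.
  induction n as [|n IH]; [simpl; ring|].
  rewrite tech5.
  rewrite (sum_eq _ (fun k => ((y - x) * x ^ k * y ^ (n - k)) * y)%R).
  - rewrite <- scal_sum, IH, Nat.sub_diag; simpl; ring.
  - intros k Hk; replace (S n - k)%nat with (S (n - k)) by lia; simpl; ring.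
Qed.

(* [inverse_table a n j] is the coefficient of index [j] of the reciprocal series, for [j <= n]. *)
Fixpoint inverse_table (a : nat -> C) (n : nat) : nat -> C :=
  match n with
  | O => fun _ => / a 0%nat
  | S n' => fun j =>
      if Nat.leb j n' then inverse_table a n' j
      else - / a 0%nat *
        sum_n (G := C_AbelianMonoid) (fun k => a (S k) * inverse_table a n' (n' - k)%nat) n'
  end.

Definition inverse_coef (a : nat -> C) (n : nat) : C := inverse_table a n n.

(** Each stage of the table copies all earlier entries, so an entry never changes once computed. *)
Lemma inverse_table_diag (a : nat -> C) (n j : nat) :
  (j <= n)%nat -> inverse_table a n j = inverse_coef a j.
Proof.
  induction n as [|n IH]; intros H.
  - now replace j with 0%nat by lia.
  - cbn [inverse_table]; destruct (Nat.leb_spec j n) as [Hj|Hj]; [now apply IH|].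
    replace j with (S n) by lia; unfold inverse_coef; cbn [inverse_table].
    destruct (Nat.leb_spec (S n) n); [lia|reflexivity].
Qed.

Lemma inverse_coef_S (a : nat -> C) (n : nat) :
  inverse_coef a (S n) =
  - / a 0%nat * sum_n (G := C_AbelianMonoid) (fun k => a (S k) * inverse_coef a (n - k)%nat) n.
Proof.
  unfold inverse_coef at 1; cbn [inverse_table].
  destruct (Nat.leb_spec (S n) n); [lia|f_equal].
  apply sum_n_ext_loc; intros k Hk; now rewrite inverse_table_diag by lia.
Qed.

Lemma inverse_coef_convolution (a : nat -> C) (n : nat) :
  a 0%nat <> 0 ->
  sum_n (G := C_AbelianMonoid) (fun k => a k * inverse_coef a (n - k)%nat) n = one_coef n.
Proof.
  intros Ha; destruct n as [|n].
  - rewrite sum_O; unfold inverse_coef; simpl; now apply Cinv_r.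
  - rewrite sum_n_shift, Nat.sub_0_r, inverse_coef_S; simpl.
    (* The two sums are convertible; with [u] for both, the recursion was chosen to make the total
       cancel. *)
    match goal with |- _ * (_ * ?u) + ?v = _ => change v with u; generalize u end.
    intros u; field; exact Ha.
Qed.

(** Strong induction on the recursion: the bounds on [a] and on the earlier reciprocal coefficients
    give a sum that telescopes to [R ^ S n - r ^ S n], which is at most [R ^ S n]. *)
Lemma inverse_coef_geometric_bound (a : nat -> C) :
  a 0%nat <> 0 -> geometric_bound a -> geometric_bound (inverse_coef a).
Proof.
  intros Ha [M [r [HM [Hr B]]]].
  pose proof (proj1 (Cmod_gt_0 _) Ha) as Ha'.
  set (q := (M / Cmod (a 0%nat))%R).
  assert (Hq : (0 <= q)%R) by (apply Rmult_le_pos; [exact HM|left; now apply Rinv_0_lt_compat]).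
  (* This ratio solves [M * K * r = R - r], with [K] the inverse modulus of the constant term; thus
     the majorant becomes exactly the telescoping sum. *)
  set (R := (r * (1 + q))%R).
  assert (HR : (r <= R)%R) by (unfold R; nra).
  set (K := (/ Cmod (a 0%nat))%R).
  assert (HK : (0 < K)%R) by now apply Rinv_0_lt_compat.
  exists K, R; split; [lra|]; split; [lra|].
  intros n; induction n as [n IH] using (well_founded_induction Wf_nat.lt_wf).
  destruct n as [|n].
  - unfold inverse_coef; simpl; rewrite Cmod_inv by exact Ha; fold K; lra.
  - rewrite inverse_coef_S, Cmod_mult, Cmod_opp, Cmod_inv by exact Ha; fold K.
    apply Rmult_le_compat_l; [lra|].
    apply Rle_trans with (sum_f_R0 (fun k => (R - r) * r ^ k * R ^ (n - k))%R n).
    + apply Cmod_sum_n_le; intros k Hk; rewrite Cmod_mult.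
      apply Rle_trans with (M * r ^ S k * (K * R ^ (n - k)))%R.
      * apply Rmult_le_compat; try apply Cmod_ge_0; [apply B|apply IH; lia].
      * right; unfold R at 2, q; fold K; unfold Rdiv; fold K; simpl; ring.
    + rewrite sum_geometric_product.
      pose proof (pow_le r (S n) ltac:(lra)); lra.
Qed.

(** The reciprocal coefficients sum to some [h] near 0. The product [g t * h t] has the expansion of
    1, hence equals 1 near 0; so [g] has no zero there and [h] is its reciprocal. *)
Lemma has_power_series_inv (g : C -> C) (a : nat -> C) :
  has_power_series g a -> a 0%nat <> 0 ->
  exists r : R, (0 < r)%R /\ (forall t : C, t <> 0 -> (Cmod t < r)%R -> g t <> 0) /\
    has_power_series (fun t => / g t) (inverse_coef a).
Proof.
  intros Hg Ha.
  destruct (geometric_bound_has_power_series (inverse_coef a)) as [h Hh].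
  { apply inverse_coef_geometric_bound; [exact Ha|].
    exact (has_power_series_geometric_bound _ _ Hg). }
  pose proof (has_power_series_mult _ _ _ _ Hg Hh) as Hgh.
  apply (has_power_series_ext _ (fun t => g t * h t) _ one_coef) in Hgh;
    [|reflexivity|intros n; now apply inverse_coef_convolution].
  destruct (has_power_series_function_unique _ _ _ Hgh has_power_series_one) as [r [Hr E]].
  assert (Hnz : forall t : C, t <> 0 -> (Cmod t < r)%R -> g t <> 0).
  { intros t Ht Hlt G0; specialize (E t Ht Hlt); rewrite G0, Cmult_0_l in E.
    apply (RtoC_neq_0 1); [lra|congruence]. }
  exists r; split; [exact Hr|]; split; [exact Hnz|].
  apply has_power_series_eventually_eq with (f := h) (r := r); [exact Hr| |exact Hh].
  intros t Ht Hlt; pose proof (Hnz t Ht Hlt).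
  replace (h t) with (/ g t * (g t * h t)) by (field; assumption).
  rewrite E by assumption; ring.
Qed.

(** * Division by t, linear operations and uniqueness of coefficients *)

Lemma has_power_series_incr (g : C -> C) (a : nat -> C) :
  has_power_series g a -> a 0%nat = 0 ->
  has_power_series (fun t => g t / t) (fun n => a (S n)).
Proof.
  intros [r [Hr H]] Ha; exists r; split; [exact Hr|]; intros t Ht Hlt.
  specialize (H t Ht Hlt).
  apply (is_series_ext (K := C_AbsRing) (V := C_NormedModule)
           (fun n => scal (/ t) (a (S n) * t ^ S n))).
  - intros n; change (/ t * (a (S n) * (t * t ^ n)) = a (S n) * t ^ n); field; exact Ht.
  - unfold Cdiv; rewrite Cmult_comm.
    apply (is_series_scal (K := C_AbsRing) (V := C_NormedModule)).
    apply (is_series_incr_1 (K := C_AbsRing) (V := C_NormedModule) (fun n => a n * t ^ n)).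
    rewrite Ha, Cmult_0_l.
    change (RtoC 0) with (zero : C_NormedModule); now rewrite plus_zero_r.
Qed.

(** Once the constant coefficient is known to be 0, division by t shows that the shifted sequence
    also represents the zero function, and induction applies. *)
Lemma has_power_series_zero (a : nat -> C) :
  has_power_series (fun _ => RtoC 0) a -> forall n, a n = 0.
Proof.
  assert (H0 : forall b, has_power_series (fun _ => RtoC 0) b -> b 0%nat = 0).
  { (* Otherwise the zero function would be invertible. *)
    intros b H; apply NNPP; intros Hb.
    destruct (has_power_series_inv _ _ H Hb) as [r [Hr [Hnz _]]].
    apply (Hnz (RtoC (r / 2))); [apply RtoC_neq_0; lra| |reflexivity].
    rewrite Cmod_R, Rabs_pos_eq; lra. }
  intros H n; revert a H; induction n as [|n IH]; intros a H; [now apply H0|].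
  apply (IH (fun n => a (S n))).
  apply has_power_series_ext with (3 := has_power_series_incr _ _ H (H0 a H));
    [|reflexivity].
  intros t _; unfold Cdiv; ring.
Qed.

Lemma has_power_series_scal (z : C) (g : C -> C) (a : nat -> C) :
  has_power_series g a -> has_power_series (fun t => z * g t) (fun n => z * a n).
Proof.
  intros [r [Hr H]]; exists r; split; [exact Hr|]; intros t Ht Hlt.
  apply (is_series_ext (K := C_AbsRing) (V := C_NormedModule)
           (fun n => scal z (a n * t ^ n))).
  - intros n; apply Cmult_assoc.
  - exact (is_series_scal (K := C_AbsRing) (V := C_NormedModule) z _ _ (H t Ht Hlt)).
Qed.

Lemma has_power_series_plus (f g : C -> C) (a b : nat -> C) :
  has_power_series f a -> has_power_series g b ->
  has_power_series (fun t => f t + g t) (fun n => a n + b n).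
Proof.
  intros [r1 [Hr1 H1]] [r2 [Hr2 H2]]; exists (Rmin r1 r2); split; [now apply Rmin_pos|].
  intros t Ht Hlt; apply Rmin_Rgt_l in Hlt; destruct Hlt as [A B].
  eapply is_series_ext;
    [|exact (is_series_plus (K := C_AbsRing) (V := C_NormedModule) _ _ _ _
               (H1 t Ht A) (H2 t Ht B))].
  intros n; symmetry; apply Cmult_plus_distr_r.
Qed.

Lemma has_power_series_unique (g : C -> C) (a b : nat -> C) :
  has_power_series g a -> has_power_series g b -> forall n, a n = b n.
Proof.
  intros Ha Hb n.
  pose proof (has_power_series_plus _ _ _ _ Ha (has_power_series_scal (- (1)) _ _ Hb)) as H.
  assert (E : a n + - (1) * b n = 0).
  { apply (has_power_series_zero (fun n => a n + - (1) * b n)).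
    apply has_power_series_ext with (3 := H); [intros t _; ring|reflexivity]. }
  replace (a n) with (a n + - (1) * b n + b n) by ring; rewrite E; ring.
Qed.

Lemma has_power_series_comp_scal (z : C) (g : C -> C) (a : nat -> C) :
  z <> 0 -> has_power_series g a ->
  has_power_series (fun t => g (z * t)) (fun n => z ^ n * a n).
Proof.
  intros Hz [r [Hr H]].
  pose proof (proj1 (Cmod_gt_0 z) Hz) as Hz'.
  exists (r / Cmod z)%R; split; [now apply Rdiv_lt_0_compat|]; intros t Ht Hlt.
  apply (is_series_ext (K := C_AbsRing) (V := C_NormedModule)
           (fun n => a n * (z * t) ^ n)); [|apply H].
  - intros n; rewrite Cpow_mult_l; change (a n * (z ^ n * t ^ n) = z ^ n * a n * t ^ n); ring.
  - now apply Cmult_neq_0.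
  - rewrite Cmod_mult, Rmult_comm; now apply Rlt_div_r.
Qed.

(** * The exponential and Bessel-Tricomi series *)

(* [ring] does not see through the canonical structures whose carrier is [C] or [R]. *)
Ltac eqC := match goal with |- @eq _ ?a ?b =>
  first [change (@eq C a b) | change (@eq R a b)] end.

Lemma RtoC_INR_fact_neq_0 (n : nat) : RtoC (INR (fact n)) <> 0.
Proof. apply RtoC_neq_0, INR_fact_neq_0. Qed.

Lemma RtoC_INR_fact_S (n : nat) :
  RtoC (INR (fact (S n))) = RtoC (INR (S n)) * RtoC (INR (fact n)).
Proof. now rewrite <- RtoC_mult, <- mult_INR. Qed.

Lemma RtoC_INR_S_neq_0 (n : nat) : RtoC (INR (S n)) <> 0.
Proof. apply RtoC_neq_0, not_0_INR; lia. Qed.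

Lemma is_series_zero_R : is_series (fun _ : nat => 0%R) 0%R.
Proof.
  unfold is_series; apply filterlim_ext with (f := fun _ : nat => 0%R);
    [|apply filterlim_const].
  intros n; rewrite sum_n_const; simpl; ring.
Qed.

Lemma is_Cseries_RtoC (u : nat -> R) (l : R) :
  is_series u l -> is_Cseries (fun n => RtoC (u n)) (RtoC l).
Proof.
  intros H; apply is_Cseries_split; split; [exact H|exact is_series_zero_R].
Qed.

Lemma sum_n_Cplus (u v : nat -> C) (n : nat) :
  sum_n (G := C_AbelianMonoid) (fun k => u k + v k) n
  = sum_n (G := C_AbelianMonoid) u n + sum_n (G := C_AbelianMonoid) v n.
Proof. apply (sum_n_plus (G := C_AbelianMonoid)). Qed.

Lemma sum_n_Cmult_l (z : C) (u : nat -> C) (n : nat) :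
  sum_n (G := C_AbelianMonoid) (fun k => z * u k) n
  = z * sum_n (G := C_AbelianMonoid) u n.
Proof. apply (sum_n_mult_l (K := C_Ring)). Qed.

(** The binomial theorem divided by [n!]. The induction step is done after multiplying by [S n],
    since a weight [k] lowers [k!] to [(k-1)!] and frees one factor [u], and likewise for [v]. *)
Lemma exp_coef_convolution (u v : C) (n : nat) :
  sum_n (G := C_AbelianMonoid) (fun k => u ^ k / RtoC (INR (fact k)) *
    (v ^ (n - k) / RtoC (INR (fact (n - k))))) n
  = (u + v) ^ n / RtoC (INR (fact n)).
Proof.
  induction n as [|n IH].
  - rewrite sum_O; simpl; eqC; field; apply RtoC_neq_0; lra.
  - pose proof (RtoC_INR_S_neq_0 n) as Hn.
    set (T := fun k => u ^ k / RtoC (INR (fact k)) *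
                (v ^ (S n - k) / RtoC (INR (fact (S n - k))))).
    assert (E : RtoC (INR (S n)) * sum_n (G := C_AbelianMonoid) T (S n)
              = (u + v) * ((u + v) ^ n / RtoC (INR (fact n)))).
    { (* The weight [S n] is split as [k + (S n - k)]. *)
      rewrite <- sum_n_Cmult_l.
      rewrite (sum_n_ext_loc _ (fun k => RtoC (INR k) * T k + RtoC (INR (S n - k)) * T k)).
      2:{ intros k Hk; rewrite minus_INR, RtoC_minus by exact Hk; eqC; ring. }
      rewrite sum_n_Cplus.
      rewrite (sum_n_shift (fun k => RtoC (INR k) * T k)).
      rewrite (sum_Sn (fun k => RtoC (INR (S n - k)) * T k)), Nat.sub_diag.
      (* The term of index 0 in the first sum and the term of index [S n] in the second have weight
         0. *)
      change (INR 0) with 0%R; rewrite !Cmult_0_l.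
      rewrite <- IH, Cmult_plus_distr_r, <- !sum_n_Cmult_l.
      change (plus ?a 0) with (a + 0); rewrite Cplus_0_l, Cplus_0_r.
      f_equal; apply sum_n_ext_loc; intros k Hk; unfold T.
      - change (S n - S k)%nat with (n - k)%nat; rewrite RtoC_INR_fact_S, Cpow_S.
        eqC; field; repeat split; try apply RtoC_INR_fact_neq_0; apply RtoC_INR_S_neq_0.
      - replace (S n - k)%nat with (S (n - k)) by lia; rewrite RtoC_INR_fact_S, Cpow_S.
        eqC; field; repeat split; try apply RtoC_INR_fact_neq_0; apply RtoC_INR_S_neq_0. }
    fold T; rewrite RtoC_INR_fact_S, Cpow_S.
    replace (sum_n T (S n)) with (/ RtoC (INR (S n)) * (RtoC (INR (S n)) * sum_n T (S n)))
      by (eqC; field; exact Hn).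
    rewrite E; eqC; field; split; [apply RtoC_INR_fact_neq_0|exact Hn].
Qed.

Lemma Ci_pow_even (n : nat) : Ci ^ (2 * n) = RtoC ((-1) ^ n).
Proof.
  rewrite Cpow_mult_r, RtoC_pow; f_equal.
  apply injective_projections; simpl; ring.
Qed.

Lemma Ci_pow_odd (n : nat) : Ci ^ (2 * n + 1) = Ci * RtoC ((-1) ^ n).
Proof. rewrite Cpow_add_r, Ci_pow_even, Cpow_1_r; apply Cmult_comm. Qed.

(** The coordinates of the powers of i are the signs of the cosine and sine series and vanish at the
    other parity. Splitting by parity leaves the zero series and the defining series in the square
    of [y]. *)
Lemma is_pseries_cos_sin (y : R) :
  is_pseries (fun n => fst (Ci ^ n)%C / INR (fact n))%R y (cos y) /\
  is_pseries (fun n => snd (Ci ^ n)%C / INR (fact n))%R y (sin y).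
Proof.
  assert (Z : forall a : nat -> R, (forall n, a n = 0%R) -> is_pseries a (y ^ 2)%R 0%R).
  { intros a Ha; apply is_pseries_R; eapply is_series_ext; [|exact is_series_zero_R].
    intros n; rewrite Ha; simpl; ring. }
  split.
  (* [is_pseries_odd_even] expects the even sum plus [y] times the odd sum. For the sine, unfolding
     already exposes a factor [y]. *)
  - replace (cos y) with (cos y + y * 0)%R by ring.
    apply is_pseries_odd_even.
    + unfold cos; destruct (exist_cos (Rsqr y)) as [l Hl]; unfold cos_in in Hl.
      apply is_pseries_R.
      eapply is_series_ext; [|apply is_series_Reals; exact Hl].
      intros n; rewrite Ci_pow_even, Rsqr_pow2; reflexivity.
    + apply Z; intros n; rewrite Ci_pow_odd; simpl; unfold Rdiv; ring.
  - replace (sin y) with (0 + sin y)%R by ring.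
    unfold sin; destruct (exist_sin (Rsqr y)) as [l Hl]; unfold sin_in in Hl.
    apply is_pseries_odd_even.
    + apply Z; intros n; rewrite Ci_pow_even; simpl; unfold Rdiv; ring.
    + apply is_pseries_R.
      eapply is_series_ext; [|apply is_series_Reals; exact Hl].
      intros n; rewrite Ci_pow_odd, Rsqr_pow2; unfold sin_n; simpl; unfold Rdiv; ring.
Qed.

Lemma fst_mult_RtoC (z : C) (a : R) : fst (z * RtoC a) = (fst z * a)%R.
Proof. simpl; ring. Qed.

Lemma snd_mult_RtoC (z : C) (a : R) : snd (z * RtoC a) = (snd z * a)%R.
Proof. simpl; ring. Qed.

Lemma is_Cseries_exp_imaginary (y : R) :
  is_Cseries (fun n => (Ci * RtoC y) ^ n / RtoC (INR (fact n))) (cos y, sin y).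
Proof.
  destruct (is_pseries_cos_sin y) as [Hc Hs].
  assert (E : forall n, (Ci * RtoC y) ^ n / RtoC (INR (fact n))
                        = Ci ^ n * RtoC (y ^ n / INR (fact n))).
  { intros n; rewrite Cpow_mult_l, RtoC_div by apply INR_fact_neq_0.
    rewrite RtoC_pow; unfold Cdiv; ring. }
  apply is_Cseries_split; split.
  - eapply is_series_ext; [|exact (proj1 (is_pseries_R _ _ _) Hc)].
    intros n; rewrite E, fst_mult_RtoC; unfold Rdiv; eqC; ring.
  - eapply is_series_ext; [|exact (proj1 (is_pseries_R _ _ _) Hs)].
    intros n; rewrite E, snd_mult_RtoC; unfold Rdiv; eqC; ring.
Qed.

Lemma Cmod_exp_term (z : C) (n : nat) :
  Cmod (z ^ n / RtoC (INR (fact n))) = (/ INR (fact n) * Cmod z ^ n)%R.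
Proof.
  rewrite Cmod_div, Cmod_pow, Cmod_R, Rabs_pos_eq;
    [unfold Rdiv; ring|apply pos_INR|apply RtoC_INR_fact_neq_0].
Qed.

Lemma ex_series_exp_abs (z : C) :
  ex_series (fun n => Cmod (z ^ n / RtoC (INR (fact n)))).
Proof.
  exists (exp (Cmod z)).
  eapply is_series_ext; [|exact (proj1 (is_pseries_R _ _ _) (is_exp_Reals (Cmod z)))].
  intros n; symmetry; apply Cmod_exp_term.
Qed.

(** [Cexp] is defined by the real exponential, cosine and sine. Its series is the Cauchy product of
    those for the real and the imaginary part of the exponent. *)
Lemma is_Cseries_Cexp (z : C) :
  is_Cseries (fun n => z ^ n / RtoC (INR (fact n))) (Cexp z).
Proof.
  destruct z as [x y].
  replace (Cexp (x, y)) with (RtoC (exp x) * (cos y, sin y))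
    by (apply injective_projections; simpl; ring).
  replace (x, y) with (RtoC x + Ci * RtoC y)
    by (apply injective_projections; simpl; ring).
  eapply is_series_ext; [intros n; apply exp_coef_convolution|].
  apply (is_Cseries_mult (fun n => RtoC x ^ n / RtoC (INR (fact n)))
           (fun n => (Ci * RtoC y) ^ n / RtoC (INR (fact n))));
    [|apply is_Cseries_exp_imaginary|apply ex_series_exp_abs|apply ex_series_exp_abs].
  eapply is_series_ext;
    [|exact (is_Cseries_RtoC _ _ (proj1 (is_pseries_R _ _ _) (is_exp_Reals x)))].
  intros n; cbv beta; rewrite RtoC_mult, RtoC_pow, RtoC_inv by apply INR_fact_neq_0.
  apply Cmult_comm.
Qed.

(** The coefficients in t of the series [sum_r u_r t^(s r)]. *)
Definition lacunary (s : nat) (u : nat -> C) (n : nat) : C :=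
  if Nat.eqb (n mod s) 0 then u (n / s)%nat else 0.

Lemma sum_n_lacunary (s : nat) (u : nat -> C) (n : nat) :
  (0 < s)%nat ->
  sum_n (G := C_AbelianMonoid) (lacunary s u) n = sum_n (G := C_AbelianMonoid) u (n / s).
Proof.
  intros Hs; induction n as [|n IH].
  - rewrite Nat.Div0.div_0_l, !sum_O; unfold lacunary.
    now rewrite Nat.Div0.mod_0_l, Nat.Div0.div_0_l.
  - rewrite sum_Sn, IH; unfold lacunary.
    pose proof (Nat.div_mod_eq n s) as E; pose proof (Nat.div_mod_eq (S n) s) as E'.
    pose proof (Nat.mod_upper_bound n s ltac:(lia)).
    pose proof (Nat.mod_upper_bound (S n) s ltac:(lia)).
    destruct (Nat.eqb_spec (S n mod s) 0) as [Hz|Hz].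
    + replace (S n / s)%nat with (S (n / s)) by nia; now rewrite sum_Sn.
    + replace (S n / s)%nat with (n / s)%nat by nia.
      apply Cplus_0_r.
Qed.

(** Inserting zeros only repeats partial sums: they are reindexed by [n / s], which tends to
    infinity. *)
Lemma is_Cseries_lacunary (s : nat) (u : nat -> C) (l : C) :
  (0 < s)%nat -> is_Cseries u l -> is_Cseries (lacunary s u) l.
Proof.
  intros Hs H; unfold is_series.
  apply filterlim_ext with (f := fun n => sum_n (G := C_AbelianMonoid) u (n / s)).
  { intros n; symmetry; now apply sum_n_lacunary. }
  apply (filterlim_comp _ _ _ (fun n => n / s)%nat
           (sum_n (G := C_AbelianMonoid) u) eventually eventually (locally l)); [|exact H].
  intros P [N HN]; exists (N * s)%nat; intros n Hn; apply HN.
  now apply Nat.div_le_lower_bound; [lia|rewrite Nat.mul_comm].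
Qed.

Lemma INR_fact_ge_1 (n : nat) : (1 <= INR (fact n))%R.
Proof. apply (le_INR 1), lt_O_fact. Qed.

(** Comparison with the exponential series gives a sum, because the extra factor [/ n!] is at most
    1. With uniqueness, [iota] must return that sum. *)
Lemma is_Cseries_bessel_tricomi0 (u : C) :
  is_Cseries (fun r => RtoC (-1) ^ r * u ^ r / RtoC (INR (fact r)) ^ 2) (bessel_tricomi0 u).
Proof.
  destruct (ex_Cseries_of_abs (fun r => RtoC (-1) ^ r * u ^ r / RtoC (INR (fact r)) ^ 2))
    as [l Hl].
  { apply (ex_series_le (K := R_AbsRing) (V := R_CompleteNormedModule) _
             (fun n => Cmod (u ^ n / RtoC (INR (fact n))))); [|apply ex_series_exp_abs].
    intros n; change (Rabs (Cmod (RtoC (-1) ^ n * u ^ n / RtoC (INR (fact n)) ^ 2))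
                      <= Cmod (u ^ n / RtoC (INR (fact n))))%R.
    rewrite Rabs_pos_eq by apply Cmod_ge_0.
    pose proof (RtoC_INR_fact_neq_0 n) as Hn.
    replace (RtoC (-1) ^ n * u ^ n / RtoC (INR (fact n)) ^ 2)
      with (RtoC (-1) ^ n * (/ RtoC (INR (fact n)) * (u ^ n / RtoC (INR (fact n)))))
      by (simpl; field; exact Hn).
    rewrite !Cmod_mult, Cmod_pow, Cmod_inv, !Cmod_R by exact Hn.
    rewrite Rabs_m1, pow1, Rabs_pos_eq, Rmult_1_l by apply pos_INR.
    rewrite <- (Rmult_1_l (Cmod (u ^ n / _))) at 2.
    apply Rmult_le_compat_r; [apply Cmod_ge_0|].
    pose proof (INR_fact_ge_1 n); rewrite <- Rinv_1; apply Rinv_le_contravar; lra. }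
  unfold bessel_tricomi0.
  rewrite (iota_unique (V := C_CompleteNormedModule) _ l); [exact Hl| |exact Hl].
  intros l' Hl'; exact (is_Cseries_unique _ _ _ Hl' Hl).
Qed.

(** The sign of the Bessel-Tricomi series cancels against the sign in [- y], so the coefficients
    contain plain powers of [y]. *)
Lemma has_power_series_bessel_tricomi0 (s : nat) (y : C) :
  (0 < s)%nat ->
  has_power_series (fun t => bessel_tricomi0 (- y * t ^ s))
    (lacunary s (fun r => y ^ r / RtoC (INR (fact r)) ^ 2)).
Proof.
  intros Hs; exists 1%R; split; [lra|]; intros t _ _.
  eapply is_series_ext;
    [|exact (is_Cseries_lacunary s _ _ Hs (is_Cseries_bessel_tricomi0 (- y * t ^ s)))].
  intros n; unfold lacunary; eqC.
  destruct (Nat.eqb_spec (n mod s) 0) as [H0|H0]; [|ring].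
  pose proof (Nat.div_mod_eq n s) as E; rewrite H0, Nat.add_0_r in E.
  set (i := (n / s)%nat) in *; clearbody i.
  rewrite E, Cpow_mult_r, !Cpow_mult_l.
  replace (- y) with (RtoC (-1) * y) by (apply injective_projections; simpl; ring).
  rewrite Cpow_mult_l.
  replace (RtoC (-1) ^ i * (RtoC (-1) ^ i * y ^ i * (t ^ s) ^ i))
    with ((RtoC (-1) * RtoC (-1)) ^ i * y ^ i * (t ^ s) ^ i)
    by (rewrite Cpow_mult_l; ring).
  replace (RtoC (-1) * RtoC (-1)) with (RtoC 1) by (rewrite <- RtoC_mult; f_equal; ring).
  rewrite Cpow_1_l; unfold Cdiv; ring.
Qed.

Lemma is_egf_iff (g : C -> C) (a : nat -> C) :
  is_egf g a <-> has_power_series g (fun n => a n / RtoC (INR (fact n))).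
Proof.
  assert (P : forall t n, pow_n (K := C_AbsRing) t n = t ^ n).
  { intros t n; induction n as [|n IH]; [reflexivity|].
    change (t * pow_n (K := C_AbsRing) t n = t ^ S n); now rewrite IH. }
  assert (Z : forall t : C, minus t (RtoC 0) = t).
  { intros t; change (t - 0 = t); ring. }
  assert (S : forall (t l : C), is_pseries (K := C_AbsRing) (V := C_NormedModule)
                (fun n => a n / RtoC (INR (fact n))) t l <->
              is_Cseries (fun n => a n / RtoC (INR (fact n)) * t ^ n) l).
  { intros t l; unfold is_pseries; split; apply is_series_ext; intros n.
    - change (pow_n (K := C_AbsRing) t n * (a n / RtoC (INR (fact n)))
              = a n / RtoC (INR (fact n)) * t ^ n).
      rewrite (P t n); apply Cmult_comm.
    - change (a n / RtoC (INR (fact n)) * t ^ n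
              = pow_n (K := C_AbsRing) t n * (a n / RtoC (INR (fact n)))).
      rewrite (P t n); apply Cmult_comm. }
  split.
  - intros [e He]; exists e; split; [apply cond_pos|]; intros t Ht Hlt.
    apply S, He; [|exact Ht].
    apply C_NormedModule_mixin_compat1; now rewrite Z.
  - intros [r [Hr H]].
    pose proof (sqrt_lt_R0 2 ltac:(lra)) as H2.
    (* Balls of [C] are squares; a square of half-side [e] lies in the disc of radius
       [sqrt 2 * e]. *)
    exists (mkposreal (r / sqrt 2) (Rdiv_lt_0_compat _ _ Hr H2)); intros t Hb Ht.
    apply S, H; [exact Ht|].
    apply C_NormedModule_mixin_compat2 in Hb; rewrite Z in Hb; simpl in Hb.
    replace r with (sqrt 2 * (r / sqrt 2))%R by (field; lra); exact Hb.
Qed.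

(** * Exponential generating functions *)

Lemma is_egf_unique (g : C -> C) (a b : nat -> C) :
  is_egf g a -> is_egf g b -> forall n, a n = b n.
Proof.
  intros Ha Hb n; apply is_egf_iff in Ha, Hb.
  pose proof (has_power_series_unique _ _ _ Ha Hb n) as E; simpl in E.
  pose proof (RtoC_INR_fact_neq_0 n) as Hn.
  replace (a n) with (a n / RtoC (INR (fact n)) * RtoC (INR (fact n))) by (field; exact Hn).
  rewrite E; field; exact Hn.
Qed.

Lemma has_power_series_is_egf (g : C -> C) (a : nat -> C) :
  has_power_series g a -> is_egf g (fun n => a n * RtoC (INR (fact n))).
Proof.
  intros H; apply is_egf_iff; apply has_power_series_ext with (3 := H); [reflexivity|].
  intros n; field; apply RtoC_INR_fact_neq_0.
Qed.

Lemma egf_coef_spec (g : C -> C) :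
  (exists a, has_power_series g a) -> is_egf g (egf_coef g).
Proof.
  intros [a H]; unfold egf_coef.
  destruct (excluded_middle_informative _) as [E|E].
  - apply proj2_sig.
  - exfalso; apply E; eexists; exact (has_power_series_is_egf _ _ H).
Qed.

Lemma egf_coef_default (g : C -> C) (n : nat) :
  ~ (exists a, has_power_series g a) -> egf_coef g n = 0.
Proof.
  intros H; unfold egf_coef.
  destruct (excluded_middle_informative _) as [[a E]|E]; [|reflexivity].
  exfalso; apply H; eexists; apply is_egf_iff; exact E.
Qed.

(** In the Cauchy product the denominators [k!] and [(n-k)!], compared with [n!], produce the
    binomial coefficient. *)
Lemma is_egf_mult (f g : C -> C) (a b : nat -> C) :
  is_egf f a -> is_egf g b ->
  is_egf (fun t => f t * g t)
    (fun n => sum_n (G := C_AbelianMonoid)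
                (fun k => RtoC (Binomial.C n k) * a k * b (n - k)%nat) n).
Proof.
  intros Ha Hb; apply is_egf_iff in Ha, Hb; apply is_egf_iff.
  apply has_power_series_ext with (3 := has_power_series_mult _ _ _ _ Ha Hb); [reflexivity|].
  intros n; unfold Cdiv; rewrite Cmult_comm.
  etransitivity; [|apply sum_n_Cmult_l].
  apply sum_n_ext_loc; intros k Hk; eqC.
  unfold Binomial.C; rewrite RtoC_div, RtoC_mult.
  2:{ apply Rmult_integral_contrapositive_currified; apply INR_fact_neq_0. }
  field; repeat split; apply RtoC_INR_fact_neq_0.
Qed.

Lemma is_egf_comp_scal (z : C) (g : C -> C) (a : nat -> C) :
  z <> 0 -> is_egf g a -> is_egf (fun t => g (z * t)) (fun n => z ^ n * a n).
Proof.
  intros Hz H; apply is_egf_iff in H; apply is_egf_iff.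
  apply has_power_series_ext with (3 := has_power_series_comp_scal z _ _ Hz H); [reflexivity|].
  intros n; unfold Cdiv; ring.
Qed.

Lemma is_egf_scal (z : C) (g : C -> C) (a : nat -> C) :
  is_egf g a -> is_egf (fun t => z * g t) (fun n => z * a n).
Proof.
  intros H; apply is_egf_iff in H; apply is_egf_iff.
  apply has_power_series_ext with (3 := has_power_series_scal z _ _ H); [reflexivity|].
  intros n; unfold Cdiv; ring.
Qed.

Lemma is_egf_ext (f g : C -> C) (a b : nat -> C) :
  (forall t : C, t <> 0 -> f t = g t) -> (forall n, a n = b n) -> is_egf f a -> is_egf g b.
Proof.
  intros Hf Hab H; apply is_egf_iff in H; apply is_egf_iff.
  apply has_power_series_ext with (3 := H); [exact Hf|intros n; now rewrite Hab].
Qed.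

Lemma has_power_series_Cexp (x : C) :
  has_power_series (fun t => Cexp (x * t)) (fun n => x ^ n / RtoC (INR (fact n))).
Proof.
  exists 1%R; split; [lra|]; intros t _ _.
  eapply is_series_ext; [|apply is_Cseries_Cexp].
  intros n; cbv beta; rewrite Cpow_mult_l; eqC; unfold Cdiv; ring.
Qed.

(** * Principal logarithm and complex powers *)

Lemma Cexp_plus (z w : C) : Cexp (z + w) = Cexp z * Cexp w.
Proof.
  destruct z as [a b], w as [c d]; apply injective_projections; simpl;
    rewrite exp_plus, ?cos_plus, ?sin_plus; ring.
Qed.

(** A positive factor changes neither the ratio of real part to modulus nor the sign of the
    imaginary part. *)
Lemma Carg_scal (r : R) (z : C) : (0 < r)%R -> z <> 0 -> Carg (RtoC r * z) = Carg z.
Proof.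
  intros Hr Hz; pose proof (proj1 (Cmod_gt_0 z) Hz) as Hz'.
  assert (E : (Re (RtoC r * z) / Cmod (RtoC r * z) = Re z / Cmod z)%R).
  { rewrite Cmod_mult, Cmod_R, Rabs_pos_eq by lra.
    replace (Re (RtoC r * z)) with (r * Re z)%R by (unfold Re; simpl; ring).
    field; lra. }
  unfold Carg; rewrite E.
  replace (Im (RtoC r * z)) with (r * Im z)%R by (unfold Im; simpl; ring).
  destruct (Rle_dec 0 (r * Im z)) as [A|A], (Rle_dec 0 (Im z)) as [B|B];
    try reflexivity; exfalso; nra.
Qed.

Lemma Clog_scal (r : R) (z : C) :
  (0 < r)%R -> z <> 0 -> Clog (RtoC r * z) = RtoC (ln r) + Clog z.
Proof.
  intros Hr Hz; pose proof (proj1 (Cmod_gt_0 z) Hz) as Hz'.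
  unfold Clog; rewrite Carg_scal, Cmod_mult, Cmod_R, Rabs_pos_eq, ln_mult by (assumption || lra).
  apply injective_projections; simpl; ring.
Qed.

Lemma Clog_RtoC (r : R) : (0 < r)%R -> Clog (RtoC r) = RtoC (ln r).
Proof.
  intros Hr; rewrite <- (Cmult_1_r (RtoC r)).
  rewrite Clog_scal; [|exact Hr|apply RtoC_neq_0; lra].
  assert (E : Clog 1 = 0); [|rewrite E; ring].
  unfold Clog, Carg; rewrite Cmod_1, ln_1; simpl.
  destruct (Rle_dec 0 0) as [_|n]; [|lra].
  unfold Rdiv; rewrite Rinv_1, Rmult_1_r, acos_1; reflexivity.
Qed.

(** A positive real factor leaves the argument unchanged, so the principal logarithm is additive
    here, without a jump by a multiple of 2 pi i. *)
Lemma Cpower_scal (r : R) (z w : C) :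
  (0 < r)%R -> z <> 0 -> Cpower (RtoC r * z) w = Cpower (RtoC r) w * Cpower z w.
Proof.
  intros Hr Hz; unfold Cpower.
  rewrite Clog_scal, Clog_RtoC, <- Cexp_plus by assumption; f_equal; ring.
Qed.

(** This separates the constant [d^nu] of the generating function from the factor [d^k] that comes
    from scaling t. *)
Lemma Cpower_plus_nat (r : R) (w : C) (k : nat) :
  (0 < r)%R -> Cpower (RtoC r) (w + RtoC (INR k)) = Cpower (RtoC r) w * RtoC r ^ k.
Proof.
  intros Hr; unfold Cpower.
  rewrite Cmult_plus_distr_r, Cexp_plus; f_equal.
  rewrite Clog_RtoC, <- RtoC_mult, <- RtoC_pow by exact Hr.
  rewrite <- Rpower_pow by exact Hr; unfold Rpower, Cexp; simpl.
  rewrite cos_0, sin_0; apply injective_projections; simpl; ring.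
Qed.

Lemma Cinv_0 : / RtoC 0 = 0.
Proof.
  apply injective_projections; simpl; unfold Rdiv; ring.
Qed.

(** Since the inverse of 0 is 0, this covers [z = 0] too, and signs can be moved out of a
    denominator wherever it may vanish. *)
Lemma Cinv_opp (z : C) : / - z = - / z.
Proof.
  destruct (Ceq_dec z 0) as [->|Hz].
  - replace (- RtoC 0) with (RtoC 0) by ring; rewrite Cinv_0; ring.
  - field; exact Hz.
Qed.

(** * Generating functions of the polynomials and of the power sums *)

Definition laguerre_apostol_base (lambda mu nu t : C) : C :=
  Cpower (RtoC 2) mu * Cpower t nu / (lambda * Cexp t + RtoC 1).

(** Convertible to the function inside [laguerre_apostol], so that facts on [egf_coef] carry over by
    unfolding. *)
Definition laguerre_apostol_gen (s m : nat) (lambda mu nu y x t : C) : C :=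
  laguerre_apostol_base lambda mu nu t ^ m * Cexp (x * t) * bessel_tricomi0 (- y * t ^ s).

Definition power_sum_gen (n : nat) (a t : C) : C :=
  (a * Cexp (RtoC (INR (n + 1)) * t) - RtoC 1) / (a * Cexp t - RtoC 1).

(** Both factors have constant term 1, which makes the product invertible as a power series. *)
Lemma has_power_series_Cexp_bessel (s : nat) (y x : C) :
  (0 < s)%nat -> exists a : nat -> C, a 0%nat <> 0 /\
    has_power_series (fun t => Cexp (x * t) * bessel_tricomi0 (- y * t ^ s)) a.
Proof.
  intros Hs.
  refine (ex_intro _ _ (conj _ (has_power_series_mult _ _ _ _ (has_power_series_Cexp x)
                                  (has_power_series_bessel_tricomi0 s y Hs)))).
  rewrite sum_O; unfold lacunary.
  rewrite Nat.sub_0_r, Nat.Div0.mod_0_l, Nat.Div0.div_0_l; simpl.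
  intros E; apply (RtoC_neq_0 1); [lra|]; rewrite <- E; field; apply RtoC_neq_0; lra.
Qed.

(** Multiply by the exponential and Bessel-Tricomi factor in one direction, and by its reciprocal
    near 0 in the other. *)
Lemma laguerre_apostol_gen_power_series_iff (s m : nat) (lambda mu nu y x : C) :
  (0 < s)%nat ->
  (exists a, has_power_series (laguerre_apostol_gen s m lambda mu nu y x) a) <->
  (exists a, has_power_series (fun t => laguerre_apostol_base lambda mu nu t ^ m) a).
Proof.
  intros Hs; destruct (has_power_series_Cexp_bessel s y x Hs) as [e [He0 He]].
  unfold laguerre_apostol_gen; split; intros [a Ha].
  - destruct (has_power_series_inv _ _ He He0) as [r [Hr [Hnz Hinv]]].
    eexists; eapply has_power_series_eventually_eq;
      [exact Hr| |exact (has_power_series_mult _ _ _ _ Ha Hinv)].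
    intros t Ht Hlt; specialize (Hnz t Ht Hlt); cbv beta.
    revert Hnz; generalize (Cexp (x * t)) (bessel_tricomi0 (- y * t ^ s)).
    intros u v Huv; field; split; intros Z; apply Huv; rewrite Z; ring.
  - eexists; eapply has_power_series_ext;
      [| |exact (has_power_series_mult _ _ _ _ Ha He)]; [|reflexivity].
    intros t _; apply Cmult_assoc.
Qed.

Lemma laguerre_apostol_gen_power_series_indep (s m : nat) (lambda mu nu y x y' x' : C) :
  (0 < s)%nat ->
  (exists a, has_power_series (laguerre_apostol_gen s m lambda mu nu y x) a) ->
  (exists a, has_power_series (laguerre_apostol_gen s m lambda mu nu y' x') a).
Proof.
  intros Hs H; apply laguerre_apostol_gen_power_series_iff; [exact Hs|].
  exact (proj1 (laguerre_apostol_gen_power_series_iff s m lambda mu nu y x Hs) H).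
Qed.

Lemma has_power_series_exp_minus_one (a x : C) :
  has_power_series (fun t => a * Cexp (x * t) - RtoC 1)
    (fun n => a * (x ^ n / RtoC (INR (fact n))) + - (1) * one_coef n).
Proof.
  eapply has_power_series_ext;
    [| |exact (has_power_series_plus _ _ _ _
               (has_power_series_scal a _ _ (has_power_series_Cexp x))
               (has_power_series_scal (- (1)) _ _ has_power_series_one))]; [|reflexivity].
  intros t _; cbv beta; ring.
Qed.

Lemma power_sum_gen_has_power_series (n : nat) (a : C) :
  exists b, has_power_series (power_sum_gen n a) b.
Proof.
  pose proof (has_power_series_exp_minus_one a (RtoC (INR (n + 1)))) as P.
  assert (Q : has_power_series (fun t => a * Cexp t - RtoC 1)
                (fun n => a * (1 ^ n / RtoC (INR (fact n))) + - (1) * one_coef n)).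
  { eapply has_power_series_ext; [| |exact (has_power_series_exp_minus_one a 1)]; [|reflexivity].
    intros t _; cbv beta; now rewrite Cmult_1_l. }
  unfold power_sum_gen.
  destruct (Ceq_dec a 1) as [->|Ha].
  - (* Numerator and denominator vanish at 0: divide both by [t]. *)
    apply has_power_series_incr in P; [|simpl; field; apply RtoC_neq_0; lra].
    apply has_power_series_incr in Q; [|simpl; field; apply RtoC_neq_0; lra].
    (* The divided denominator has constant term 1. *)
    destruct (has_power_series_inv _ _ Q) as [r [Hr [Hnz Hinv]]].
    { simpl; intros E; apply (RtoC_neq_0 1); [lra|].
      rewrite <- E; field; apply RtoC_neq_0; lra. }
    eexists; eapply has_power_series_eventually_eq;
      [exact Hr| |exact (has_power_series_mult _ _ _ _ P Hinv)].
    intros t Ht Hlt; specialize (Hnz t Ht Hlt); cbv beta.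
    revert Hnz; generalize (1 * Cexp t - RtoC 1); intros u Hu.
    field; split; [|exact Ht]; intros Z; apply Hu; rewrite Z; field; exact Ht.
  (* Here the denominator has the nonzero constant term [a - 1]. *)
  - destruct (has_power_series_inv _ _ Q) as [r [Hr [Hnz Hinv]]].
    { simpl; intros E; apply Ha.
      replace a with (a * (1 / RtoC 1) + - (1) * 1 + 1) by (field; apply RtoC_neq_0; lra).
      rewrite E; ring. }
    eexists; eapply has_power_series_ext;
      [| |exact (has_power_series_mult _ _ _ _ P Hinv)]; reflexivity.
Qed.

(** * The symmetric generating function and the identity *)

(* The generating function, in [t], of one side of the identity. *)
Definition symmetry_gen (s c d m : nat) (lambda mu nu x y X Y t : C) : C :=
  Cpower (RtoC (INR d)) nu *
  ((power_sum_gen (c - 1) (- lambda) (RtoC (INR d) * t) *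
    laguerre_apostol_gen s (m - 1) lambda mu nu
      (RtoC (INR c) ^ s * Y) (RtoC (INR c) * X) (RtoC (INR d) * t)) *
   laguerre_apostol_gen s m lambda mu nu
     (RtoC (INR d) ^ s * y) (RtoC (INR d) * x) (RtoC (INR c) * t)).

Lemma symmetry_gen_comm (s c d m : nat) (lambda mu nu x y X Y t : C) :
  (0 < c)%nat -> (0 < d)%nat -> (0 < m)%nat -> t <> 0 ->
  symmetry_gen s c d m lambda mu nu x y X Y t = symmetry_gen s d c m lambda mu nu x y X Y t.
Proof.
  intros Hc Hd Hm Ht; destruct m as [|m]; [lia|].
  pose proof (lt_0_INR _ Hc) as Hc'; pose proof (lt_0_INR _ Hd) as Hd'.
  unfold symmetry_gen, power_sum_gen, laguerre_apostol_gen.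
  replace (S m - 1)%nat with m by lia.
  (* As [c] and [d] are positive, the numerators of both power sums contain the exponential of the
     same [c d t]. *)
  replace (c - 1 + 1)%nat with c by lia; replace (d - 1 + 1)%nat with d by lia.
  set (c' := INR c) in *; set (d' := INR d) in *; clearbody c' d'.
  rewrite !Cpow_S, !Cpow_mult_l.
  replace (RtoC c' * (RtoC d' * t)) with (RtoC d' * (RtoC c' * t)) by ring.
  replace (RtoC c' * X * (RtoC d' * t)) with (RtoC d' * X * (RtoC c' * t)) by ring.
  replace (RtoC d' * x * (RtoC c' * t)) with (RtoC c' * x * (RtoC d' * t)) by ring.
  replace (- (RtoC c' ^ s * Y) * (RtoC d' ^ s * t ^ s))
    with (- (RtoC d' ^ s * Y) * (RtoC c' ^ s * t ^ s)) by ring.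
  replace (- (RtoC d' ^ s * y) * (RtoC c' ^ s * t ^ s))
    with (- (RtoC c' ^ s * y) * (RtoC d' ^ s * t ^ s)) by ring.
  (* At [a = - lambda] numerator and denominator of a power sum are negatives of
     [lambda e^(...) + 1], and the signs cancel. *)
  assert (E : forall u, - lambda * u - RtoC 1 = - (lambda * u + RtoC 1)) by (intros; ring).
  rewrite !E; unfold Cdiv; rewrite !Cinv_opp.
  (* Each side holds both of these powers and one further base factor, from the higher order. Only
     that factor is opened; its denominator and that of the power sum become the atoms [u] and
     [v]. *)
  generalize (laguerre_apostol_base lambda mu nu (RtoC c' * t) ^ m)
    (laguerre_apostol_base lambda mu nu (RtoC d' * t) ^ m); intros U V.
  unfold laguerre_apostol_base, Cdiv; rewrite !Cpower_scal by assumption.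
  generalize (/ (lambda * Cexp (RtoC c' * t) + RtoC 1))
    (/ (lambda * Cexp (RtoC d' * t) + RtoC 1)); intros u v.
  ring.
Qed.

(** Two nested binomial convolutions. The inner one is taken at [d t], which gives [d^k]; the factor
    of order [m] is taken at [c t], which gives [c^(n-k)]. *)
Lemma symmetry_gen_is_egf (s c d m : nat) (lambda mu nu x y X Y : C) :
  (0 < c)%nat -> (0 < d)%nat ->
  (exists a, has_power_series (laguerre_apostol_gen s m lambda mu nu
               (RtoC (INR d) ^ s * y) (RtoC (INR d) * x)) a) ->
  (exists a, has_power_series (laguerre_apostol_gen s (m - 1) lambda mu nu
               (RtoC (INR c) ^ s * Y) (RtoC (INR c) * X)) a) ->
  is_egf (symmetry_gen s c d m lambda mu nu x y X Y)
    (fun n => sum_n (G := C_AbelianMonoid) (fun k =>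
       RtoC (Binomial.C n k) * RtoC (INR c) ^ (n - k)
       * Cpower (RtoC (INR d)) (nu + RtoC (INR k))
       * laguerre_apostol s m lambda mu nu (n - k)
           (RtoC (INR d) ^ s * y) (RtoC (INR d) * x)
       * sum_n (G := C_AbelianMonoid) (fun l =>
           RtoC (Binomial.C k l) * power_sum l (c - 1) (- lambda)
           * laguerre_apostol s (m - 1) lambda mu nu (k - l)
               (RtoC (INR c) ^ s * Y) (RtoC (INR c) * X)) k) n).
Proof.
  intros Hc Hd H1 H2.
  pose proof (lt_0_INR _ Hc) as Hc'; pose proof (lt_0_INR _ Hd) as Hd'.
  pose proof (RtoC_neq_0 (INR c) ltac:(lra)) as Hc0.
  pose proof (RtoC_neq_0 (INR d) ltac:(lra)) as Hd0.
  pose proof (is_egf_comp_scal _ _ _ Hc0 (egf_coef_spec _ H1)) as E1.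
  pose proof (is_egf_comp_scal _ _ _ Hd0
    (is_egf_mult _ _ _ _
      (egf_coef_spec _ (power_sum_gen_has_power_series (c - 1) (- lambda)))
      (egf_coef_spec _ H2))) as E2.
  pose proof (is_egf_scal (Cpower (RtoC (INR d)) nu) _ _ (is_egf_mult _ _ _ _ E2 E1)) as E3.
  eapply is_egf_ext; [| |exact E3]; [reflexivity|].
  intros n; cbv beta; rewrite <- sum_n_Cmult_l.
  apply sum_n_ext_loc; intros k Hk; eqC.
  rewrite Cpower_plus_nat by exact Hd'.
  unfold laguerre_apostol, power_sum, laguerre_apostol_gen, laguerre_apostol_base, power_sum_gen.
  ring.
Qed.

Lemma sum_n_C_zero (u : nat -> C) (n : nat) :
  (forall k, u k = 0) -> sum_n (G := C_AbelianMonoid) u n = RtoC 0.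
Proof.
  intros H; induction n as [|n IH]; [now rewrite sum_O|].
  rewrite sum_Sn, IH, H; apply Cplus_0_l.
Qed.

Theorem corollary3p3 (s c d n m : nat) (lambda mu nu x y X Y : C)
  (hs : (0 < s)%nat) (hc : (0 < c)%nat) (hd : (0 < d)%nat) (hm : (0 < m)%nat) :
  let F := fun (order j : nat) (v u : C) =>
    laguerre_apostol s order lambda mu nu j v u in
  let c' := RtoC (INR c) in
  let d' := RtoC (INR d) in
  sum_n (fun k : nat =>
    RtoC (Binomial.C n k) * c' ^ (n - k) * Cpower d' (nu + RtoC (INR k))
    * F m (n - k)%nat (d' ^ s * y) (d' * x)
    * sum_n (fun l : nat =>
        RtoC (Binomial.C k l) * power_sum l (c - 1) (- lambda)
        * F (m - 1)%nat (k - l)%nat (c' ^ s * Y) (c' * X)) k) n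
  = sum_n (fun k : nat =>
    RtoC (Binomial.C n k) * d' ^ (n - k) * Cpower c' (nu + RtoC (INR k))
    * F m (n - k)%nat (c' ^ s * y) (c' * x)
    * sum_n (fun l : nat =>
        RtoC (Binomial.C k l) * power_sum l (d - 1) (- lambda)
        * F (m - 1)%nat (k - l)%nat (d' ^ s * Y) (d' * X)) k) n.
Proof.
  intros F c' d'; unfold F, c', d'.
  (* One missing expansion forces the default value 0 for every pair of arguments of that order, so
     the pair (0, 0) can decide existence below. *)
  assert (Z : forall order y0 x0,
    ~ (exists a, has_power_series (laguerre_apostol_gen s order lambda mu nu y0 x0) a) ->
    forall j y1 x1, laguerre_apostol s order lambda mu nu j y1 x1 = 0).
  { intros order y0 x0 H j y1 x1.
    apply (egf_coef_default (laguerre_apostol_gen s order lambda mu nu y1 x1)).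
    intros H1; apply H, laguerre_apostol_gen_power_series_indep with (1 := hs) (2 := H1). }
  destruct (classic (exists a, has_power_series (laguerre_apostol_gen s m lambda mu nu 0 0) a))
    as [H1|H1].
  (* Without order [m], every outer term has a zero factor on both sides. *)
  2:{ transitivity (RtoC 0); [|symmetry]; apply sum_n_C_zero; intros k;
        rewrite (Z _ _ _ H1); ring. }
  destruct (classic (exists a,
      has_power_series (laguerre_apostol_gen s (m - 1) lambda mu nu 0 0) a)) as [H2|H2].
  (* Without order [m - 1], every inner sum vanishes. *)
  2:{ assert (Z' : forall b k y1 x1, sum_n (G := C_AbelianMonoid) (fun l =>
          RtoC (Binomial.C k l) * power_sum l b (- lambda) *
          laguerre_apostol s (m - 1) lambda mu nu (k - l) y1 x1) k = RtoC 0).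
      { intros b k y1 x1; apply sum_n_C_zero; intros l; rewrite (Z _ _ _ H2); ring. }
      transitivity (RtoC 0); [|symmetry]; apply sum_n_C_zero; intros k;
        etransitivity; [|apply Cmult_0_r| |apply Cmult_0_r];
        f_equal; apply Z'. }
  assert (H1' : forall y1 x1,
    exists a, has_power_series (laguerre_apostol_gen s m lambda mu nu y1 x1) a)
    by (intros; exact (laguerre_apostol_gen_power_series_indep _ _ _ _ _ _ _ _ _ hs H1)).
  assert (H2' : forall y1 x1,
    exists a, has_power_series (laguerre_apostol_gen s (m - 1) lambda mu nu y1 x1) a)
    by (intros; exact (laguerre_apostol_gen_power_series_indep _ _ _ _ _ _ _ _ _ hs H2)).
  pose proof (symmetry_gen_is_egf s c d m lambda mu nu x y X Y hc hd (H1' _ _) (H2' _ _)) as L.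
  pose proof (symmetry_gen_is_egf s d c m lambda mu nu x y X Y hd hc (H1' _ _) (H2' _ _)) as R.
  (* Symmetry makes both coefficient sequences expand the same function; uniqueness then equates
     them at [n]. *)
  eapply is_egf_ext in L;
    [|intros t Ht; exact (symmetry_gen_comm s c d m lambda mu nu x y X Y t hc hd hm Ht)
     |reflexivity].
  exact (is_egf_unique _ _ _ L R n).
Qed.
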